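(* Let $H \in \mathbb{R}^{m \times n}$ with $n > m$ and $\operatorname{rank} H = m$, and let $\sigma_{\max}$ and $\sigma_{\min}$ be the squares of the largest and smallest singular values of $H$, respectively. For $\lambda > 0$ let $$\kappa(\lambda) := \frac{\frac{\lambda + \sqrt{\lambda^2 + 4\,\sigma_{\max}}}{2}}{\min\left\{\lambda,\ \frac{\sqrt{\lambda^2 + 4\,\sigma_{\min}} - \lambda}{2}\right\}}.$$ Then the minimizer of $\kappa$ over $\lambda > 0$ is $$\lambda^{\star} := \underset{\lambda > 0}{\operatorname{argmin}}\ \kappa(\lambda) = \sqrt{\frac{\sigma_{\min}}{2}}.$$
   Context: The singular values of $H \in \mathbb{R}^{m\times n}$ (with $\operatorname{rank} H = m < n$) are its $m$ positive singular values, i.e. $\sigma_{\min}$ and $\sigma_{\max}$ are the smallest and largest eigenvalues of $H H^{\top}$. The function $\kappa(\lambda)$ is the (spectral, 2-norm) condition number of the KKT matrix $K = \begin{bmatrix} \lambda I & H^{\top} \\ H & 0 \end{bmatrix} \in \mathbb{R}^{(n+m)\times(n+m)}$, where $I$ is the $n\times n$ identity. *)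

(* Defs.v *)
From mathcomp Require Import all_boot all_order all_algebra.
From mathcomp Require Import boolp classical_sets reals.

Set Implicit Arguments.
Unset Strict Implicit.
Unset Printing Implicit Defensive.

Import Order.TTheory GRing.Theory Num.Theory.

Local Open Scope classical_set_scope.
Local Open Scope ring_scope.

(* Meant for wide matrices (m <= n), for which all the singular values of H,
   zero included, are the square roots of the eigenvalues of the m x m Gram
   matrix H H^T.  Multiplicities are forgotten. *)
Definition singular_values (R : realType) (m n : nat) (H : 'M[R]_(m, n)) :
    set R :=
  [set s | 0 <= s /\ eigenvalue (H *m H^T) (s ^+ 2)].

(* Spectral condition number of the KKT matrix [lambda I, H^T; H, 0] as a
   function of lambda, where sigma_max and sigma_min are the squares of the extreme
   singular values of H.  The eigenvalues of that matrix are lambda and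
   (lambda +/- sqrt (lambda ^ 2 + 4 s)) / 2 for s an eigenvalue of H H^T. *)
Definition kappa (R : realType) (sigma_max sigma_min lambda : R) : R :=
  ((lambda + Num.sqrt (lambda ^+ 2 + 4 * sigma_max)) / 2) /
  Num.min lambda ((Num.sqrt (lambda ^+ 2 + 4 * sigma_min) - lambda) / 2).

Definition argmin (R : realType) (D : set R) (f : R -> R) : set R :=
  [set x | D x /\ forall y, D y -> f x <= f y].

(* Main.v *)
Require Import Defs.
From mathcomp Require Import all_boot all_order all_algebra.
From mathcomp Require Import boolp classical_sets reals.
From mathcomp Require Import ring lra.

(** Write [N x = (x + sqrt (x^2 + 4 a)) / 2] for the numerator of [kappa a b],
    and [d x = (sqrt (x^2 + 4 b) - x) / 2] for the second entry of the minimum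
    in its denominator.  The two entries of that minimum cross exactly at
    [c = sqrt (b / 2)]: as [b = 2 c^2], the root there is [3 c] and [d c = c].
    Each entry alone is an upper bound of the minimum, hence
    - to the left of [c], [kappa x >= N x / x], and [N x / x] is strictly
      decreasing because it is [(1 + sqrt (1 + 4 a / x^2)) / 2]
      ([numerator_ratio_decreasing]);
    - to the right of [c], [kappa x >= N x / d x], where [N] is strictly
      increasing and [d x < c] ([numerator_increasing], [gap_lt]).
    Both bounds exceed [N c / c = kappa c], so [c] is the only minimizer
    ([kappa_gt]).  This needs [a, b > 0], which is where the rank of [H] enters:
    full row rank makes the Gram matrix [H H^T] definite, so no singular value
    vanishes ([singular_value_gt0]). *)

Import Order.TTheory GRing.Theory Num.Theory.

Local Open Scope classical_set_scope.
Local Open Scope ring_scope.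

(** The single entry of [u u^T] is a sum of squares, those of the entries of
    [u]. *)
Lemma row_self_dot_eq0 (R : realDomainType) (n : nat) (u : 'rV[R]_n) :
  u *m u^T = 0 -> u = 0.
Proof.
move=> /matrixP/(_ 0 0); rewrite !mxE => /eqP.
rewrite psumr_eq0 => [/allP u0|j _]; last by rewrite mxE -expr2 sqr_ge0.
apply/rowP => j; have := u0 j (mem_index_enum j).
by rewrite !mxE /= mulf_eq0 orbb => /eqP.
Qed.

(** If [v H H^T = 0], then [v H] is orthogonal to itself, hence zero, and the
    rows of [H] are independent. *)
Lemma singular_value_gt0 (R : realType) (m n : nat) (H : 'M[R]_(m, n)) (s : R) :
  \rank H = m -> singular_values H s -> 0 < s.
Proof.
move=> rkH [s_ge0 /eigenvalueP[v vHH v_neq0]].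
rewrite lt_neqAle s_ge0 andbT; apply/eqP => s0.
move: vHH; rewrite -s0 expr0n /= scale0r mulmxA => vHH.
have vH0 : v *m H = 0.
  by apply: row_self_dot_eq0; rewrite trmx_mul mulmxA vHH mul0mx.
have freeH : row_free H by rewrite /row_free rkH.
by move: v_neq0; rewrite (row_free_inj freeH (etrans vH0 (esym (mul0mx _ _)))) eqxx.
Qed.

Lemma numerator_increasing (R : rcfType) (a x y : R) :
  0 <= a -> 0 < x -> x < y ->
  (x + Num.sqrt (x ^+ 2 + 4 * a)) / 2 < (y + Num.sqrt (y ^+ 2 + 4 * a)) / 2.
Proof.
move=> a0 x0 xy; rewrite ltr_pM2r ?invr_gt0 ?ltr0n //.
by apply: ltr_leD => //; apply: ler_wsqrtr; nra.
Qed.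

Lemma numerator_ratio_decreasing (R : rcfType) (a x y : R) :
  0 < a -> 0 < x -> x < y ->
  (y + Num.sqrt (y ^+ 2 + 4 * a)) / 2 / y < (x + Num.sqrt (x ^+ 2 + 4 * a)) / 2 / x.
Proof.
move=> a0 x0 xy; have y0 := lt_trans x0 xy.
(* The squares of the two sides share the term [x^2 y^2], and what remains is
   [4 a x^2 < 4 a y^2]. *)
have cross : x * Num.sqrt (y ^+ 2 + 4 * a) < y * Num.sqrt (x ^+ 2 + 4 * a).
  rewrite -(ltr_pXn2r (n := 2)) ?nnegrE ?mulr_ge0 ?sqrtr_ge0 ?ltW //.
  rewrite !exprMn !sqr_sqrtr; [|nra|nra].
  rewrite !mulrDr [y ^+ 2 * x ^+ 2]mulrC ltrD2l ltr_pM2r; [nra|lra].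
by rewrite ltr_pdivrMr // mulrAC ltr_pdivlMr //; lra.
Qed.

(** The claim is [sqrt (x^2 + 8 c^2) < x + 2 c], and the squares of the two sides
    differ by [4 c (x - c)]; [gap_at] is the equality case [x = c]. *)
Lemma gap_lt (R : rcfType) (c x : R) :
  0 < c -> c < x -> (Num.sqrt (x ^+ 2 + 4 * (2 * c ^+ 2)) - x) / 2 < c.
Proof.
move=> c0 cx.
suff : Num.sqrt (x ^+ 2 + 4 * (2 * c ^+ 2)) < x + 2 * c by lra.
rewrite -(ltr_pXn2r (n := 2)) ?nnegrE ?sqrtr_ge0 //; last lra.
by rewrite sqr_sqrtr; nra.
Qed.

Lemma gap_at (R : rcfType) (c : R) :
  0 < c -> (Num.sqrt (c ^+ 2 + 4 * (2 * c ^+ 2)) - c) / 2 = c.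
Proof.
move=> c0; have -> : c ^+ 2 + 4 * (2 * c ^+ 2) = (3 * c) ^+ 2 by ring.
by rewrite sqrtr_sqr ger0_norm; [field | lra].
Qed.

Lemma gap_gt0 (R : rcfType) (b x : R) :
  0 < b -> 0 < x -> 0 < (Num.sqrt (x ^+ 2 + 4 * b) - x) / 2.
Proof.
move=> b0 x0; suff : x < Num.sqrt (x ^+ 2 + 4 * b) by lra.
rewrite -(ltr_pXn2r (n := 2)) ?nnegrE ?sqrtr_ge0 ?ltW //.
by rewrite sqr_sqrtr; nra.
Qed.

(** The second parameter is written [2 c^2] so that the crossing point of the
    two entries of the minimum is [c] itself. *)
Lemma kappa_gt (R : realType) (a c x : R) :
  0 < a -> 0 < c -> 0 < x -> x != c ->
  kappa a (2 * c ^+ 2) c < kappa a (2 * c ^+ 2) x.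
Proof.
move=> a0 c0 x0; rewrite /kappa gap_at // minxx.
have b0 : 0 < 2 * c ^+ 2 by nra.
have gx := gap_gt0 _ _ _ b0 x0.
set d := (_ - x) / 2 in gx *; set N := (x + _) / 2.
have N0 : 0 < N.
  by rewrite divr_gt0 ?ltr0n // ltr_wpDr ?sqrtr_ge0.
have min0 : 0 < Num.min x d by rewrite lt_min x0.
have bound e : 0 < e -> Num.min x d <= e -> N / e <= N / Num.min x d.
  by move=> e0 le_e; rewrite ler_pM2l // lef_pV2 ?posrE.
rewrite neq_lt => /orP[xc | cx].
  apply: lt_le_trans (bound x x0 _); last by rewrite ge_min lexx.
  exact: numerator_ratio_decreasing.
apply: lt_le_trans (bound d gx _); last by rewrite ge_min lexx orbT.
apply: (@lt_trans _ _ (N / c)).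
  by rewrite ltr_pM2r ?invr_gt0 // numerator_increasing // ltW.
by rewrite ltr_pM2l // ltf_pV2 ?posrE // gap_lt.
Qed.

Theorem theorem1 (R : realType) (m n : nat) (H : 'M[R]_(m, n))
    (hmn : (m < n)%N) (hrank : \rank H = m)
    (s_max s_min : R)
    (hmax : singular_values H s_max) (ub_max : ubound (singular_values H) s_max)
    (hmin : singular_values H s_min) (lb_min : lbound (singular_values H) s_min)
    (sigma_max sigma_min : R)
    (hsigma_max : sigma_max = s_max ^+ 2) (hsigma_min : sigma_min = s_min ^+ 2) :
  argmin [set lambda : R | 0 < lambda] (kappa sigma_max sigma_min)
  = [set Num.sqrt (sigma_min / 2)].
Proof.
have a0 : 0 < sigma_max.
  by rewrite hsigma_max exprn_gt0 // (singular_value_gt0 _ _ _ H).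
have b0 : 0 < sigma_min.
  by rewrite hsigma_min exprn_gt0 // (singular_value_gt0 _ _ _ H).
set c := Num.sqrt _.
have c0 : 0 < c by rewrite sqrtr_gt0 divr_gt0 ?ltr0n.
have -> : sigma_min = 2 * c ^+ 2.
  by rewrite sqr_sqrtr ?divr_ge0 ?ler0n ?ltW //; field.
apply/seteqP; split=> [x [/= x0 x_min] | x ->].
  apply: contrapT => /eqP xc.
  by have := x_min c c0; rewrite leNgt kappa_gt.
split=> // y y0; have [-> // | yc] := eqVneq y c.
by rewrite ltW ?kappa_gt.
Qed.
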